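(* Let $d \geqslant 1$ and $k \geqslant 2$ be integers. For every $k$-self-similar set $X \subset [0,1]^{d}$ we have $$\dim_{\mathcal{H}}(X) = h(X),$$ where $\dim_{\mathcal{H}}(X)$ is the Hausdorff dimension of $X$ and $h(X)$ is the entropy of $X$ (defined using the base-$k$ logarithm).
   Context: **$k$-self-similar sets.** Let $X \subset [0,1]^{d}$ be compact and let $k \geqslant 2$ be an integer. For an integer $a \geqslant 0$ and $\mathbf{b} = (b_1,\ldots,b_d) \in \mathbb{Z}^d$ with $0 \leqslant b_i < k^a$ for each $i$, set $$\mathcal{K}_{a,\mathbf{b}}^{k} := \Big\{(k^{a}x_{1}-b_{1},\ldots,k^{a}x_{d}-b_{d}) \;:\; (x_{1},\ldots,x_{d}) \in X \cap \prod_{i=1}^{d}\Big[\frac{b_{i}}{k^{a}},\frac{b_{i}+1}{k^{a}}\Big]\Big\} \subset [0,1]^d.$$ The $k$-kernel of $X$ is the collection $\mathcal{K}_X^k = \{\mathcal{K}_{a,\mathbf{b}}^{k} : a \geqslant 0,\ 0 \leqslant b_i < k^a\}$ of all such sets. The compact set $X$ is called $k$-self-similar if $\mathcal{K}_X^k$ is finite. **The language $\mathcal{L}_X$.** The alphabet is $\varSigma_k^d = \{0,\ldots,k-1\}^d$. A base-$k$ representation of $t \in [0,1]$ is a sequence $(b^{(1)}, b^{(2)}, \ldots)$ with $b^{(j)} \in \{0,\ldots,k-1\}$ and $t = \sum_{j \geqslant 1} b^{(j)} k^{-j}$ (so representations have the form $0.b^{(1)}b^{(2)}\cdots$; a number having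 two such representations is considered with both of them; $0$ and $1$ have only one each). For $x = (x_1,\ldots,x_d) \in X$ and any choice, for each $i$, of a base-$k$ representation $(b_i^{(1)}, b_i^{(2)},\ldots)$ of $x_i$, form the infinite word $\mathbf{w}$ over $\varSigma_k^d$ whose $j$-th letter is $(b_1^{(j)},\ldots,b_d^{(j)})$. The language $\mathcal{L}_X$ is the set of all finite words consisting of consecutive letters (at positions $m+1,\ldots,m+p$, for $m,p \geqslant 0$) of some such infinite word $\mathbf{w}$, over all $x \in X$ and all choices of representations of the coordinates. **Entropy.** For $n \geqslant 1$ let $\mathcal{P}(\mathcal{L}_X,n)$ be the number of words of length $n$ in $\mathcal{L}_X$. Since $\mathcal{L}_X$ is closed under taking subwords (blocks of consecutive letters), $\mathcal{P}(\mathcal{L}_X,n+m) \leqslant \mathcal{P}(\mathcal{L}_X,n)\mathcal{P}(\mathcal{L}_X,m)$, and the entropy of $X$ is $$h(X) = \lim_{n\to\infty} \frac{1}{n}\log_k\big(\mathcal{P}(\mathcal{L}_X,n)\big).$$ *)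

(* Defs.v *)
From HB Require Import structures.
From mathcomp Require Import all_boot all_order all_algebra.
From mathcomp Require Import all_classical all_reals all_analysis.

Set Implicit Arguments.
Unset Strict Implicit.
Unset Printing Implicit Defensive.

Import Order.TTheory GRing.Theory Num.Theory.
Import numFieldNormedType.Exports.

Local Open Scope classical_set_scope.
Local Open Scope ring_scope.

Section HausdorffDimension.
Context {R : realType} {d : nat}.
Implicit Types (A U : set 'rV[R]_d) (s delta : R).

(* The norm that the library puts on 'rV[R]_d is the sup norm; diameters are
   taken for the Euclidean distance. *)
Definition euclidean_dist (x y : 'rV[R]_d) : R :=
  Num.sqrt (\sum_(i < d) (x ord0 i - y ord0 i) ^+ 2).

(* This is -oo for the empty set. *)
Definition diameter U : \bar R :=
  ereal_sup [set (euclidean_dist p.1 p.2)%:E | p in U `*` U].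

(* The empty set contributes 0 for every s, in particular for s = 0; a
   singleton contributes 1 for s = 0, since 0 `^ 0 = 1. *)
Definition diameter_pow s U : \bar R :=
  if pselect (U = set0) then 0%E else poweR (diameter U) s.

Definition hausdorff_premeasure s delta A : \bar R :=
  ereal_inf [set (\sum_(0 <= i <oo) diameter_pow s (U i))%E | U in
    [set U : nat -> set 'rV[R]_d |
      A `<=` \bigcup_i U i /\ forall i, (diameter (U i) <= delta%:E)%E]].

(* The premeasure is nonincreasing in delta, so that its limit as delta tends
   to 0 from the right is a supremum. *)
Definition hausdorff_measure s A : \bar R :=
  ereal_sup [set hausdorff_premeasure s delta A | delta in
    [set delta : R | 0 < delta]].

Definition hausdorff_dim A : \bar R :=
  ereal_inf [set s%:E | s in
    [set s : R | 0 <= s /\ hausdorff_measure s A = 0%E]].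

End HausdorffDimension.

Section SelfSimilar.
Context {R : realType} {d : nat}.
Implicit Types (k : nat) (X : set 'rV[R]_d).

Definition unit_cube : set 'rV[R]_d :=
  [set x : 'rV[R]_d | forall i, 0 <= x ord0 i <= 1].

Definition kadic_cube k (a : nat) (b : 'I_d -> nat) : set 'rV[R]_d :=
  [set x : 'rV[R]_d | forall i,
    (b i)%:R / (k ^ a)%:R <= x ord0 i <= (b i).+1%:R / (k ^ a)%:R].

Definition kernel_elt k X (a : nat) (b : 'I_d -> nat) : set 'rV[R]_d :=
  [set \row_i ((k ^ a)%:R * x ord0 i - (b i)%:R) | x in
    X `&` kadic_cube k a b].

Definition kkernel k X : set (set 'rV[R]_d) :=
  [set Y | exists (a : nat) (b : 'I_d -> nat),
    (forall i, (b i < k ^ a)%N) /\ Y = kernel_elt k X a b].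

Definition self_similar k X : Prop :=
  [/\ X `<=` unit_cube, compact X & finite_set (kkernel k X)].

End SelfSimilar.

Section Entropy.
Context {R : realType} {d : nat}.

Definition letter k := {ffun 'I_d -> 'I_k}.

(* Digit sequences and infinite words are indexed from 0: b j is the digit in
   position j + 1. *)
Definition base_repr k (b : nat -> 'I_k) (t : R) : Prop :=
  series (fun j => (b j)%:R / k%:R ^+ j.+1 : R) @ \oo --> t.

Definition word_of_point k (x : 'rV[R]_d) (w : nat -> letter k) : Prop :=
  forall i, base_repr (fun j => w j i) (x ord0 i).

Definition language k (X : set 'rV[R]_d) : set (seq (letter k)) :=
  [set u | exists x w m p,
    [/\ X x, word_of_point x w & u = mkseq (fun j => w (m + j)%N) p]].
Arguments language : clear implicits.

Definition complexity (A : finType) (L : set (seq A)) (n : nat) : nat :=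
  #|[set u : n.-tuple A | `[< L (tval u) >] ]%SET|.

(* The limit exists because n |-> ln (complexity (language k X) n) is
   subadditive. If X is empty then, as ln 0 = 0, the entropy is 0, which
   is also the Hausdorff dimension of the empty set. *)
Definition entropy k (X : set 'rV[R]_d) : R :=
  limn (fun n => ln (complexity (language k X) n)%:R / ln k%:R / n%:R : R).

End Entropy.

(* Main.v *)
(* Let W be the set of infinite words representing the points of X. The kernel of
   X corresponds to the residuals u^-1 W, so there are finitely many of them.

   If H^s(X) = 0, compactness turns a cheap cover of X into a finite set C of
   words such that every element of W has a prefix in C and the sum of k^(-s|u|)
   over C is as small as desired. Keeping the words of C that extend a given u
   gives such a cover, of weight at most 1, for each residual; since there are
   finitely many residuals the lengths in these covers are bounded, and a renewal
   argument shows that the language has O(k^(sn)) words of length n.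

   Conversely the words of length n give a cover of X by cubes of side k^(-n), so
   H^s'(X) = 0 whenever there are at most k^(sn) words for infinitely many n and
   s < s'. The two bounds squeeze the sequence defining the entropy. *)

Require Import Defs.
From mathcomp Require Import all_boot all_order all_algebra.
From mathcomp Require Import all_classical all_reals all_analysis.
From mathcomp Require Import ring lra zify.

Set Implicit Arguments.
Unset Strict Implicit.
Unset Printing Implicit Defensive.

Import Order.TTheory GRing.Theory Num.Theory.
Import numFieldNormedType.Exports.

Local Open Scope classical_set_scope.
Local Open Scope ring_scope.

(** * Words and base-k representations *)

(** The default [w 0] is never reached; it lets [A] be any type, with no chosen inhabitant. *)
Definition prepend {A : Type} (u : seq A) (w : nat -> A) : nat -> A :=
  fun n => if (n < size u)%N then nth (w 0%N) u n else w (n - size u)%N.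

Lemma mkseq_prepend (A : Type) (u : seq A) w n :
  mkseq (prepend u w) (size u + n) = u ++ mkseq w n.
Proof.
apply: (@eq_from_nth _ (w 0%N)); first by rewrite size_cat !size_mkseq.
move=> j; rewrite size_mkseq => jn.
rewrite nth_mkseq // nth_cat /prepend; case: ltnP => // uj.
by rewrite nth_mkseq // ltn_subLR.
Qed.

Lemma mkseq_prepend_take (A : Type) (u : seq A) w n :
  (n <= size u)%N -> mkseq (prepend u w) n = take n u.
Proof.
move=> nu; apply: (@eq_from_nth _ (w 0%N)).
  by rewrite size_mkseq size_takel.
move=> j; rewrite size_mkseq => jn.
by rewrite nth_mkseq // nth_take // /prepend (leq_trans jn nu).
Qed.

Lemma prepend_mkseq_shift (A : Type) (w : nat -> A) m :
  prepend (mkseq w m) (fun j => w (m + j)%N) = w.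
Proof.
apply/funext => n; rewrite /prepend size_mkseq; case: ltnP => nm.
  by rewrite nth_mkseq.
by rewrite subnKC.
Qed.

Lemma prepend_cat (A : Type) (u v : seq A) w :
  prepend u (prepend v w) = prepend (u ++ v) w.
Proof.
apply/funext => n; rewrite /prepend size_cat nth_cat.
case: (ltnP n (size u)) => nu.
  by rewrite (leq_trans nu (leq_addr _ _)); apply: set_nth_default.
rewrite ltn_subLR // ; case: ltnP => // nuv.
by rewrite subnDA.
Qed.

Lemma mkseq_shift (A : Type) (w : nat -> A) m n :
  mkseq w m ++ mkseq (fun j => w (m + j)%N) n = mkseq w (m + n).
Proof.
have := mkseq_prepend (mkseq w m) (fun j => w (m + j)%N) n.
by rewrite prepend_mkseq_shift size_mkseq.
Qed.

Section Digits.
Context {R : realType} {d k : nat} (hk : (2 <= k)%N).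
Implicit Types (u v : seq (letter (d := d) k)) (i : 'I_d) (x y : 'rV[R]_d).
Implicit Types w : nat -> letter (d := d) k.

Let k_gt0 : (0 < k)%N. Proof. exact: ltnW. Qed.

Lemma base_exp_gt0 n : 0 < (k ^ n)%:R :> R.
Proof. by rewrite ltr0n expn_gt0 k_gt0. Qed.

(** The integer whose base-[k] digits, most significant first, are the [i]-th coordinates of the
    letters: the corner of the cube of [u], in units of [k ^- size u]. *)
Definition word_coord u i : nat := foldl (fun (a : nat) (l : letter k) => a * k + l i)%N 0%N u.

Lemma word_coord_rcons u (l : letter k) i : word_coord (rcons u l) i = (word_coord u i * k + l i)%N.
Proof. by rewrite /word_coord -cats1 foldl_cat. Qed.

Lemma word_coord_mkseqS w n i : word_coord (mkseq w n.+1) i = (word_coord (mkseq w n) i * k + w n i)%N.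
Proof. by rewrite mkseqS word_coord_rcons. Qed.

Lemma word_coord_cat u v i : word_coord (u ++ v) i = (word_coord u i * k ^ size v + word_coord v i)%N.
Proof.
elim/last_ind: v => [|v l IH]; first by rewrite cats0 expn0 muln1 addn0.
by rewrite -rcons_cat !word_coord_rcons IH size_rcons expnS; lia.
Qed.

Lemma word_coord_lt u i : (word_coord u i < k ^ size u)%N.
Proof.
elim/last_ind: u => [|u l IH]; first by rewrite expn0.
rewrite word_coord_rcons size_rcons expnS; have := ltn_ord (l i); nia.
Qed.

Lemma word_coord_inj u v : size u = size v -> (forall i, word_coord u i = word_coord v i) -> u = v.
Proof.
elim/last_ind: u v => [|u l IH] v; first by move/esym/size0nil ->.
case/lastP: v => [|v l']; first by rewrite size_rcons.
rewrite !size_rcons => -[suv] H.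
have E i : word_coord u i = word_coord v i /\ l i = l' i.
  have := H i; rewrite !word_coord_rcons => h.
  have hl := ltn_ord (l i); have hl' := ltn_ord (l' i).
  have e : word_coord u i = word_coord v i by nia.
  by split=> //; apply: val_inj => /=; rewrite e in h; lia.
congr rcons; first by apply: IH => // i; case: (E i).
by apply/ffunP => i; case: (E i).
Qed.

Lemma series_word_coord w i n :
  series (fun j => (w j i)%:R / k%:R ^+ j.+1 : R) n
  = (word_coord (mkseq w n) i)%:R / (k ^ n)%:R.
Proof.
have k0 : k%:R != 0 :> R by rewrite pnatr_eq0 -lt0n.
rewrite /series /=; elim: n => [|n IH]; first by rewrite big_geq // mul0r.
rewrite big_nat_recr //= IH word_coord_mkseqS natrD natrM !natrX exprS; field.
by rewrite k0 expf_neq0.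
Qed.

Definition cell n (b : 'I_d -> nat) x :=
  forall i, (b i)%:R <= (k ^ n)%:R * x ord0 i <= (b i)%:R + 1.

Lemma cell_mkseq_pred w n x :
  cell n.+1 (word_coord (mkseq w n.+1)) x -> cell n (word_coord (mkseq w n)) x.
Proof.
move=> H i; have := H i; rewrite word_coord_mkseqS expnS natrD !natrM.
have k0 : 0 < k%:R :> R by rewrite ltr0n.
have : (w n i)%:R + 1 <= k%:R :> R.
  by rewrite natr1 ler_nat ltn_ord.
have : 0 <= (w n i)%:R :> R by [].
move: (w n i)%:R (word_coord _ i)%:R (k ^ n)%:R => l c p l0 l1 /andP[h1 h2].
have h3 : c * k%:R < (p * x ord0 i + 1) * k%:R by nra.
have h1' : c * k%:R <= p * x ord0 i * k%:R by nra.
have h2' : p * x ord0 i * k%:R <= (c + 1) * k%:R by nra.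
by apply/andP; split; [rewrite -(ler_pM2r k0)|rewrite -(ler_pM2r k0)].
Qed.

Lemma cell_mkseq_le w m n x : (m <= n)%N ->
  cell n (word_coord (mkseq w n)) x -> cell m (word_coord (mkseq w m)) x.
Proof.
move=> /subnKC <-; elim: (n - m)%N => [|j IH]; first by rewrite addn0.
by rewrite addnS => /cell_mkseq_pred /IH.
Qed.

(* Turns the limit defining representations into a condition on finite prefixes. *)
Lemma word_of_pointP x w :
  word_of_point x w <-> forall n, cell n (word_coord (mkseq w n)) x.
Proof.
split=> [H n i|H i].
  have := H i; rewrite /base_repr => cv.
  pose S n : R := (word_coord (mkseq w n) i)%:R / (k ^ n)%:R.
  have cvS : S @ \oo --> x ord0 i.
    rewrite (_ : S = series (fun j => (w j i)%:R / k%:R ^+ j.+1)) //.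
    by apply/funext => m; rewrite series_word_coord.
  (* The partial sums increase, and all digits after position [m] add at most [k ^- m]; both bounds
     pass to the limit. *)
  have SnnS m j : S m <= S (m + j)%N <= ((word_coord (mkseq w m) i)%:R + 1) / (k ^ m)%:R.
    rewrite /S ler_pdivlMr ?base_exp_gt0 // ler_pdivrMr ?base_exp_gt0 // expnD.
    rewrite natrM -mkseq_shift word_coord_cat size_mkseq natrD natrM.
    have := word_coord_lt (mkseq (fun j => w (m + j)%N) j) i; rewrite size_mkseq.
    set c := word_coord (mkseq (fun _ => _) _) i; rewrite -(ltr_nat R).
    have := base_exp_gt0 m; have := base_exp_gt0 j.
    have : 0 <= c%:R :> R by [].
    move: c%:R (word_coord _ i)%:R (k ^ j)%:R (k ^ m)%:R => {}c a p q c0 p0 q0 cp.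
    rewrite !mulrA !divfK ?gt_eqF //; nra.
  rewrite mulrC; apply/andP; split.
    rewrite -ler_pdivrMr ?base_exp_gt0 //; apply: (cvgr_to_ge cvS); near=> m.
    by rewrite -(@subnKC n m); [case/andP: (SnnS n (m - n)%N)|near: m; exists n].
  rewrite -ler_pdivlMr ?base_exp_gt0 //; apply: (cvgr_to_le cvS); near=> m.
  by rewrite -(@subnKC n m); [case/andP: (SnnS n (m - n)%N)|near: m; exists n].
rewrite /base_repr (_ : series _ = fun n => (word_coord (mkseq w n) i)%:R / (k ^ n)%:R); last first.
  by apply/funext => m; rewrite series_word_coord.
apply: (@squeeze_cvgr _ _ _ _ (fun n => x ord0 i - k%:R^-1 ^+ n) (fun=> x ord0 i)).
- near=> n; have := H n i; have p0 := base_exp_gt0 n.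
  have -> : k%:R^-1 ^+ n = (k ^ n)%:R^-1 :> R by rewrite natrX exprVn.
  rewrite ler_pdivrMr // ler_pdivlMr // mulrBl mulVf ?gt_eqF // (mulrC (x _ _)) lerBlDr.
  by rewrite andbC.
- rewrite -[X in _ --> X]subr0; apply: cvgB; first exact: cvg_cst.
  apply: cvg_expr; rewrite ger0_norm ?invr_ge0 // invf_lt1 ?ltr0n // ltr1n //.
- exact: cvg_cst.
Unshelve. all: by end_near.
Qed.

(** Dropping the digits of [u] amounts to rescaling the cube of [u] to the unit cube. This links
    residuals of the set of words to kernel elements. *)
Lemma word_of_point_prepend u x w :
  word_of_point x (prepend u w) <->
  word_of_point (\row_i ((k ^ size u)%:R * x ord0 i - (word_coord u i)%:R)) w.
Proof.
have E n : cell (size u + n) (word_coord (mkseq (prepend u w) (size u + n))) x <->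
    cell n (word_coord (mkseq w n)) (\row_i ((k ^ size u)%:R * x ord0 i - (word_coord u i)%:R)).
  split=> H i; have := H i; rewrite mkseq_prepend word_coord_cat size_mkseq mxE;
  rewrite natrD natrM expnD natrM => /andP[h1 h2]; apply/andP; split; lra.
split => /word_of_pointP H; apply/word_of_pointP => n.
  by apply/E; apply: H.
(* The rescaled point only controls prefixes of length at least [size u]; shorter ones follow since
   cells are nested. *)
apply: (@cell_mkseq_le _ n (size u + n)); first exact: leq_addl.
exact/E.
Qed.

Lemma word_of_point_exists x : unit_cube x -> exists w, word_of_point x w.
Proof.
move=> x01.
(* Greedy digit: the integer part of [k * t], except at [t = 1], where the digit [k - 1] leaves the
   remainder 1 again. *)
have step (t : R) : exists l : 'I_k, 0 <= t <= 1 -> 0 <= k%:R * t - l%:R <= 1.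
  case: (boolP (0 <= t < 1)) => [/andP[t0 t1]|/negP tn].
    have kt : 0 <= k%:R * t by rewrite mulr_ge0.
    have h := truncn_itv kt.
    have lk : (Num.truncn (k%:R * t) < k)%N.
      rewrite -(ltr_nat R); case/andP: h => h _; apply: le_lt_trans h _.
      by rewrite -[ltRHS]mulr1 ltr_pM2l // ltr0n.
    exists (Ordinal lk) => _ /=; case/andP: h; rewrite -natr1; lra.
  have lk : (k.-1 < k)%N by lia.
  exists (Ordinal lk) => /andP[t0 t1] /=.
  have -> : t = 1 by apply/eqP; rewrite eq_le t1 leNgt; apply/negP => ?; apply: tn; rewrite t0.
  by rewrite mulr1 -{1 3}(prednK k_gt0) -natr1 addrAC subrr add0r lexx ler01.
have [D HD] := choice step.
(* [T i n] is the remainder after [n] digits of the [i]-th coordinate; it stays in [0, 1]. *)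
pose T i := fix T n : R := if n is m.+1 then k%:R * T m - (D (T m))%:R else x ord0 i.
pose w n : letter k := [ffun i => D (T i n)].
have T01 i n : 0 <= T i n <= 1.
  by elim: n => [|n IH] /=; [exact: x01|exact: HD].
have HT n i : (k ^ n)%:R * x ord0 i = (word_coord (mkseq w n) i)%:R + T i n.
  elim: n => [|n IH]; first by rewrite expn0 mul1r add0r.
  by rewrite expnS natrM -mulrA IH word_coord_mkseqS natrD natrM ffunE /=; ring.
exists w; apply/word_of_pointP => n i; rewrite HT.
by case/andP: (T01 i n) => h1 h2; apply/andP; split; lra.
Qed.

Lemma cell_kadic_cube a b x : cell a b x <-> kadic_cube k a b x.
Proof.
split=> H i; have := H i;
by rewrite /kadic_cube /= ler_pdivrMr ?base_exp_gt0 // ler_pdivlMr ?base_exp_gt0 //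
   -[(b i).+1%:R]natr1 mulrC.
Qed.

End Digits.
Arguments cell {R d} k n b x.

(** * Counting words through residuals *)

Definition residual {A : Type} (W : set (nat -> A)) (u : seq A) : set (nat -> A) :=
  [set w | W (prepend u w)].

Lemma residual_cat (A : Type) (W : set (nat -> A)) u v :
  residual (residual W u) v = residual W (u ++ v).
Proof. by apply/seteqP; split=> w; rewrite /residual /= prepend_cat. Qed.

Definition factor {A : Type} (W : set (nat -> A)) : set (seq A) :=
  [set u | exists w m p, W w /\ u = mkseq (fun j => w (m + j)%N) p].

Definition cylinder_cover {A : eqType} (W : set (nat -> A)) (C : seq (seq A)) :=
  forall w, W w -> exists2 u, u \in C & u = mkseq w (size u).

Section SymbolicCount.
Context {R : realType} {A : finType} (lam : R) (W : set (nat -> A)).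
Hypothesis lam1 : 1 <= lam.
Hypothesis residual_fin : finite_set (range (residual W)).
Hypothesis small_cover : forall (eps : R) N, 0 < eps ->
  exists C : seq (seq A), [/\ all (fun u => (N <= size u)%N) C,
    \sum_(u <- C) (lam ^+ size u)^-1 <= eps & cylinder_cover W C].

Let lam_gt0 n : 0 < lam ^+ n.
Proof. by apply: exprn_gt0; apply: lt_le_trans lam1. Qed.

(** Take a cover of [W] by words longer than [u] and of weight at most [lam ^- size u], and keep the
    words that extend [u]. Deleting the prefix [u] multiplies their weight by [lam ^+ size u], which
    gives at most 1. *)
Lemma residual_small_cover (u : seq A) :
  exists C : seq (seq A), [/\ all (fun v => (0 < size v)%N) C,
    \sum_(v <- C) (lam ^+ size v)^-1 <= 1 & cylinder_cover (residual W u) C].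
Proof.
have [|C [Csize Csum Ccov]] := @small_cover (lam ^+ size u)^-1 (size u).+1.
  by rewrite invr_gt0.
exists [seq drop (size u) v | v <- C & take (size u) v == u]; split.
- apply/allP => _ /mapP[v + ->]; rewrite mem_filter => /andP[_ /(allP Csize)].
  by rewrite size_drop subn_gt0.
- rewrite big_map big_filter -(ler_pM2l (_ : 0 < (lam ^+ size u)^-1)) ?invr_gt0 //.
  rewrite mulr1; apply: le_trans Csum.
  rewrite mulr_sumr [leRHS](bigID (fun v => take (size u) v == u)) /=.
  apply: ler_wpDr; first by apply: sumr_ge0 => v _; rewrite invr_ge0 ltW.
  rewrite big_seq_cond [leRHS]big_seq_cond.
  apply: ler_sum => v /andP[/(allP Csize) sv _].
  by rewrite size_drop -invfM -exprD subnKC // ltnW.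
- move=> w /Ccov[v vC ev]; have sv := allP Csize v vC.
  have tu : take (size u) v = u.
    by rewrite ev -(subnKC (ltnW sv)) mkseq_prepend take_size_cat.
  exists (drop (size u) v).
    by apply/mapP; exists v => //; rewrite mem_filter tu eqxx.
  rewrite {1}ev -{1}(subnKC (ltnW sv)) mkseq_prepend drop_size_cat //.
  by rewrite size_drop.
Qed.

(* Cutting off the first block of a word, chosen in the cover of its residual,
   gives the renewal inequality
   [N_V n <= sum_(u in C_V) N_(residual V u) (n - |u|)]
   for the numbers of prefixes; since [sum_(u in C_V) lam ^- |u| <= 1], the bound
   [N_V n <= K lam ^ n] is inherited from small [n]. *)
Lemma prefix_count : exists2 K : R, 0 < K & forall n u,
  exists2 L : seq (seq A), (size L)%:R <= K * lam ^+ n &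
    forall w, residual W u w -> mkseq w n \in L.
Proof.
have [s Es] := (iffLR (finite_seqP _)) residual_fin.
have resP u : residual W u \in s.
  by have : range (residual W) (residual W u) by [exists u]; rewrite Es.
(* The cover is chosen per residual, not per word, so only finitely many covers occur and their word
   lengths have a common bound [M]. *)
have /choice[F HF] V : exists C : seq (seq A), range (residual W) V ->
    [/\ all (fun v => (0 < size v)%N) C,
        \sum_(v <- C) (lam ^+ size v)^-1 <= 1 & cylinder_cover V C].
  have [[u _ <-]|nV] := pselect (range (residual W) V).
    by have [C HC] := residual_small_cover u; exists C.
  by exists [::].
pose M := (\max_(V <- s) \max_(v <- F V) size v)%N.
have sizeM u v : v \in F (residual W u) -> (size v <= M)%N.
  move=> vF; apply: (@leq_trans (\max_(v <- F (residual W u)) size v)%N).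
    exact: (@leq_bigmax_seq _ _ xpredT size).
  exact: (@leq_bigmax_seq _ _ xpredT (fun V => \max_(v <- F V) size v)%N).
(* This bounds the number of all words of length less than [M], which settles small [n]; the
   successor keeps the base positive if [A] is empty. *)
exists ((#|A|.+1 ^ M)%:R); first by rewrite ltr0n expn_gt0.
elim/ltn_ind => n IH u.
have [nM|Mn] := ltnP n M.
  exists [seq tval t | t <- enum {: n.-tuple A}].
    rewrite size_map -cardE card_tuple.
    apply: (@le_trans _ _ (#|A|.+1 ^ M)%:R).
      rewrite ler_nat; apply: (@leq_trans (#|A|.+1 ^ n)).
        by have [->|n0] := posnP n; rewrite ?expn0 ?leq_exp2r.
      by rewrite leq_pexp2l // ltnW.
    by rewrite ler_peMr // exprn_ege1.
  by move=> w _; apply/mapP; exists [tuple of mkseq w n] => //; rewrite mem_enum.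
have [] := HF (residual W u); first by exists u.
set C := F _ => Cpos Csum Ccov.
have /choice[G HG] v : exists L : seq (seq A), v \in C ->
    (size L)%:R <= (#|A|.+1 ^ M)%:R * lam ^+ (n - size v)
    /\ forall w, residual W (u ++ v) w -> mkseq w (n - size v) \in L.
  have [vC|nC] := boolP (v \in C); last by exists [::].
  have v0 : (0 < size v)%N := allP Cpos v vC; have vM := sizeM _ _ vC.
  have [|L L1 L2] := IH (n - size v)%N _ (u ++ v); first by lia.
  by exists L.
exists (flatten [seq [seq v ++ t | t <- G v] | v <- C]).
  rewrite size_flatten /shape -map_comp sumnE big_map natr_sum.
  apply: (@le_trans _ _ (\sum_(v <- C) ((#|A|.+1 ^ M)%:R * lam ^+ n) * (lam ^+ size v)^-1)).
    rewrite big_seq [leRHS]big_seq; apply: ler_sum => v vC /=.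
    rewrite size_map; apply: (le_trans (HG v vC).1).
    rewrite -mulrA ler_pM2l ?ltr0n ?expn_gt0 // ler_pdivlMr // -exprD subnK //.
    exact: leq_trans (sizeM _ _ vC) Mn.
  rewrite -mulr_sumr -[leRHS]mulr1 ler_pM2l //.
  by rewrite mulr_gt0 // ltr0n expn_gt0.
move=> w Ww; have [v vC ev] := Ccov w Ww; have vM := sizeM _ _ vC.
apply/flatten_mapP; exists v => //; apply/mapP.
exists (mkseq (fun j => w (size v + j)%N) (n - size v)).
  apply: (HG v vC).2; rewrite -residual_cat /residual /= {1}ev.
  by rewrite prepend_mkseq_shift.
by rewrite {1}ev mkseq_shift subnKC // (leq_trans vM Mn).
Qed.

(** A factor starting at position [m] is a prefix of an element of the residual by the first [m]
    letters, so factors are counted by summing the prefix bound over the finitely many residuals. *)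
Lemma complexity_le : exists2 K : R, 0 < K &
  forall n, (complexity (factor W) n)%:R <= K * lam ^+ n.
Proof.
have [K K0 HK] := prefix_count.
have [s Es] := (iffLR (finite_seqP _)) residual_fin.
exists ((size s).+1%:R * K); first by rewrite mulr_gt0.
move=> n.
have /choice[G HG] V : exists L : seq (seq A), range (residual W) V ->
    (size L)%:R <= K * lam ^+ n /\ forall w, V w -> mkseq w n \in L.
  have [[u _ <-]|nV] := pselect (range (residual W) V).
    by have [L L1 L2] := HK n u; exists L.
  by exists [::].
have sP V : V \in s -> range (residual W) V by rewrite Es.
pose L := flatten [seq G V | V <- s].
have sL : (size L)%:R <= (size s)%:R * (K * lam ^+ n).
  rewrite size_flatten /shape -map_comp sumnE big_map natr_sum.
  apply: (@le_trans _ _ (\sum_(V <- s) K * lam ^+ n)).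
    by rewrite big_seq [leRHS]big_seq; apply: ler_sum => V /sP/HG[].
  by rewrite big_const_seq count_predT iter_addr_0 mulr_natl.
apply: (@le_trans _ _ (size L)%:R); last first.
  apply: le_trans sL _; rewrite -mulrA ler_pM2r ?ler_nat // mulr_gt0 //.
rewrite ler_nat /complexity cardE -(size_map (@tval n A)).
apply: uniq_leq_size; first by rewrite map_inj_uniq ?enum_uniq //; exact: val_inj.
move=> _ /mapP[t + ->]; rewrite mem_enum inE => /asboolP[w [m [p [Ww et]]]].
have ep : p = n by rewrite -(size_tuple t) et size_mkseq.
apply/flatten_mapP; exists (residual W (mkseq w m)).
  by have : range (residual W) (residual W (mkseq w m)) by [exists (mkseq w m)]; rewrite Es.
rewrite et ep; apply: (HG _ _).2; first by exists (mkseq w m).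
by rewrite /residual /= prepend_mkseq_shift.
Qed.

End SymbolicCount.

(** * Residuals of the set of words representing a self-similar set *)

Definition words {R : realType} {d : nat} k (X : set 'rV[R]_d) :
    set (nat -> letter (d := d) k) :=
  [set w | exists2 x, X x & word_of_point x w].
Arguments words {R d} k X.

Lemma language_factor (R : realType) d k (X : set 'rV[R]_d) :
  @language R d k X = factor (words k X).
Proof.
apply/seteqP; split=> [u [x [w [m [p [Xx xw ->]]]]]|u [w [m [p [[x Xx xw] ->]]]]].
  by exists w, m, p; split => //; exists x.
by exists x, w, m, p.
Qed.

(** The residual by [u] is the set of words of the kernel element at level [size u] and corner
    [word_coord u]. *)
Lemma residual_words_finite (R : realType) d k (X : set 'rV[R]_d) :
  (2 <= k)%N -> finite_set (kkernel k X) ->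
  finite_set (range (residual (words k X))).
Proof.
move=> hk kfin; apply: (sub_finite_set _ (finite_image (words k) kfin)).
move=> _ [u _ <-]; exists (kernel_elt k X (size u) (word_coord u)).
  by exists (size u), (word_coord u); split => // i; apply: word_coord_lt.
have k0 := base_exp_gt0 hk (R := R) (size u).
apply/seteqP; split=> w.
  move=> [_ [x [Xx xu] <-] xw]; exists x => //.
  exact/(word_of_point_prepend hk).
move=> [x Xx xw]; move/(word_of_point_prepend hk): (xw) => yw.
exists (\row_i ((k ^ size u)%:R * x ord0 i - (word_coord u i)%:R)) => //; exists x => //.
split => //; apply/(cell_kadic_cube hk).
have /(word_of_pointP hk)/(_ (size u)) := xw.
by rewrite mkseq_prepend_take // take_size.
Qed.

(** * Covers of null sets by cylinders *)

Section HausdorffPremeasure.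
Context {R : realType} {d : nat}.
Implicit Types (X U : set 'rV[R]_d) (x y : 'rV[R]_d).

Lemma coord_dist_le x y i : `|x ord0 i - y ord0 i| <= euclidean_dist x y.
Proof.
rewrite /euclidean_dist -sqrtr_sqr ler_sqrt ?sqr_ge0 //; last first.
  by apply: sumr_ge0 => j _; rewrite sqr_ge0.
by rewrite (bigD1 i) //= lerDl; apply: sumr_ge0 => j _; rewrite sqr_ge0.
Qed.

Lemma euclidean_dist_le_diameter U x y : U x -> U y ->
  ((euclidean_dist x y)%:E <= diameter U)%E.
Proof. by move=> Ux Uy; apply: ereal_sup_ubound; exists (x, y). Qed.

Lemma diameter_ge0 U : U !=set0 -> (0 <= diameter U)%E.
Proof.
move=> [x Ux]; apply: le_trans (euclidean_dist_le_diameter Ux Ux).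
by rewrite lee_fin /euclidean_dist sqrtr_ge0.
Qed.

Lemma diameter_pow_ge0 s U : (0 <= diameter_pow s U)%E.
Proof. by rewrite /diameter_pow; case: pselect => U0 //; apply: poweR_ge0. Qed.

Lemma hausdorff_null_cover s X (delta eps : R) : 0 < delta -> 0 < eps ->
  hausdorff_measure s X = 0%E ->
  exists U : nat -> set 'rV[R]_d, [/\ X `<=` \bigcup_i U i,
    forall i, (diameter (U i) <= delta%:E)%E &
    (\sum_(0 <= i <oo) diameter_pow s (U i) < eps%:E)%E].
Proof.
move=> delta0 eps0 H.
have : (hausdorff_premeasure s delta X < eps%:E)%E.
  apply: (@le_lt_trans _ _ (hausdorff_measure s X)); last by rewrite H lte_fin.
  by apply: ereal_sup_ubound; exists delta.
by move=> /ereal_inf_lt[y [U [XU dU] <-] lt]; exists U.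
Qed.

End HausdorffPremeasure.

Section NullSets.
Context {R : realType} {d k : nat} (hk : (2 <= k)%N).
Implicit Types (X : set 'rV[R]_d) (x : 'rV[R]_d).

Let k_gt0 : (0 < k)%N. Proof. exact: ltnW. Qed.

Lemma powR_base_expV (s : R) n :
  ((k ^ n)%:R^-1) `^ s = ((k%:R `^ s) ^+ n)^-1 :> R.
Proof.
rewrite -powR_inv1 // -powRrM mulrC powRrM natrX -powR_mulrn // powR_inv1 ?powR_ge0 //.
by rewrite -powRrM mulrC powRrM powR_mulrn ?powR_ge0.
Qed.

Lemma base_powR_ge1 (s : R) : 0 <= s -> 1 <= k%:R `^ s.
Proof.
by move=> s0; rewrite -[leLHS](powRr0 k%:R) ler_powR // ler1n.
Qed.

Lemma base_powR_gt1 (s : R) : 0 < s -> 1 < k%:R `^ s.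
Proof.
move=> s0; rewrite -[ltLHS](congr1 (fun f => f s) (@powR1 R)).
by rewrite gt0_ltr_powR // ?nnegrE // ltr1n.
Qed.

Lemma expr_lt_eventually (z eps : R) : 0 <= z < 1 -> 0 < eps ->
  exists N, forall n, (N <= n)%N -> z ^+ n < eps.
Proof.
move=> /andP[z0 z1] e0.
have cv : (z ^+ n @[n --> \oo] --> 0)%classic by apply: cvg_expr; rewrite ger0_norm.
by have [N _ HN] := @cvgr_lt _ _ _ _ _ _ cv _ e0; exists N.
Qed.

Lemma base_expV_lt_eventually (eps : R) : 0 < eps ->
  exists N, forall n, (N <= n)%N -> (k ^ n)%:R^-1 < eps.
Proof.
move=> e0; have [|N HN] := @expr_lt_eventually k%:R^-1 eps _ e0.
  by rewrite invr_ge0 ler0n /= invf_lt1 ?ltr1n // ltr0n.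
by exists N => n /HN; rewrite natrX -exprVn.
Qed.

(** Rounds a diameter up to a scale [k ^- n] smaller than [k * D], at the cost of a factor [k ^ s].
    The slack [eps] serves [D = 0] with [s > 0], where [n] is just taken large; for [s = 0] all
    weights are 1. *)
Lemma scale_exists (D s eps : R) N : 0 <= s -> 0 < eps ->
  0 <= D -> D <= (k ^ N)%:R^-1 ->
  exists n, [/\ (N <= n)%N, D <= (k ^ n)%:R^-1 &
    ((k%:R `^ s) ^+ n)^-1 <= k%:R `^ s * D `^ s + eps].
Proof.
move=> s0 e0; rewrite le_eqVlt => /predU1P[<- _|D0 DN].
  have [->|sn0] := eqVneq s 0.
    exists N; split => //.
    by rewrite !powRr0 expr1n invr1 mulr1 lerDl ltW.
  have sgt0 : 0 < s by rewrite lt_neqAle eq_sym sn0.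
  have l1 := base_powR_gt1 sgt0.
  have [|M HM] := @expr_lt_eventually (k%:R `^ s)^-1 eps _ e0.
    by rewrite invr_ge0 powR_ge0 /= invf_lt1 // (lt_trans _ l1).
  have h := HM _ (leq_maxr N M).
  exists (maxn N M); split => //; first exact: leq_maxl.
  by rewrite powR0 // mulr0 add0r -exprVn ltW.
have exm : exists m, (k ^ m)%:R^-1 < D.
  by have [n h] := base_expV_lt_eventually D0; exists n; apply: h.
case: (ex_minnP exm) => m mD mmin.
have Nm : (N < m)%N.
  rewrite ltnNge; apply/negP => mN; have := lt_le_trans mD DN.
  by rewrite ltf_pV2 ?posrE ?base_exp_gt0 // ltr_nat ltnNge leq_pexp2l.
case: m => // m in mD mmin Nm *.
have Dm : D <= (k ^ m)%:R^-1 by rewrite leNgt; apply/negP => /mmin; rewrite ltnn.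
exists m; split => //.
rewrite -powR_base_expV -powRM //; last exact: ltW.
apply: (@le_trans _ _ ((k%:R * D) `^ s)); last by rewrite lerDl ltW.
apply: ge0_ler_powR => //; rewrite ?nnegrE ?invr_ge0 ?ler0n //.
  by rewrite mulr_ge0 // ltW.
move: mD; rewrite expnS natrM invfM => mD.
have k0 : 0 < k%:R :> R by rewrite ltr0n.
by rewrite -ler_pdivrMl // ltW.
Qed.

(** A point within [2 k ^- n] of [x] in each coordinate has its length-[n] prefixes here: its scaled
    coordinates differ from those of [x] by less than 2, and from the corner of its cell by at most
    1. *)
Definition words_near n x : {set n.-tuple (letter (d := d) k)} :=
  [set t : n.-tuple (letter k) | `[< forall i,
    `|(word_coord t i)%:R - (k ^ n)%:R * x ord0 i| < 3 >]]%SET.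

(* Reduction of the coordinates modulo 6 is injective on words whose
   coordinates lie in a common window of length less than 6. *)
Lemma card_words_near n x : (#|words_near n x| <= 6 ^ d)%N.
Proof.
pose f (t : n.-tuple (letter (d := d) k)) : {ffun 'I_d -> 'I_6} :=
  [ffun i => inord (word_coord t i %% 6)].
have finj : {in words_near n x &, injective f}.
  move=> t t'; rewrite !inE => /asboolP ht /asboolP ht' ff.
  apply/val_inj/(word_coord_inj hk) => [|i]; first by rewrite !size_tuple.
  have := congr1 (fun g : {ffun 'I_d -> 'I_6} => val (g i)) ff.
  rewrite !ffunE /= !inordK ?ltn_mod //.
  have := ht i; have := ht' i; rewrite !ltr_norml => /andP[a1 a2] /andP[b1 b2].
  have l1 : (word_coord t i < word_coord t' i + 6)%N.
    by rewrite -(ltr_nat R) natrD; lra.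
  have l2 : (word_coord t' i < word_coord t i + 6)%N.
    by rewrite -(ltr_nat R) natrD; lra.
  by move: l1 l2; move: (word_coord t i) (word_coord t' i) => p q; clear; lia.
rewrite -(card_in_imset finj); apply: leq_trans (max_card _) _.
by rewrite card_ffun !card_ord.
Qed.

Lemma sum_half_pow M : \sum_(0 <= i < M) (2 ^+ i.+1)^-1 <= 1 :> R.
Proof.
suff -> : \sum_(0 <= i < M) (2 ^+ i.+1)^-1 = 1 - (2 ^+ M)^-1 :> R.
  by rewrite lerBlDr lerDl invr_ge0 exprn_ge0.
elim: M => [|M IH]; first by rewrite big_geq // expr0 invr1 subrr.
rewrite big_nat_recr //= IH exprS; field.
by rewrite expf_neq0.
Qed.

(** Each covering set is rounded to a scale [k ^- n] with [n >= N], at which at most [6 ^ d] words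
    meet it; compactness leaves finitely many sets. *)
Lemma null_small_cylinder_cover (s : R) X (eps : R) N : 0 <= s -> compact X ->
  hausdorff_measure s X = 0%E -> 0 < eps ->
  exists C : seq (seq (letter (d := d) k)), [/\ all (fun u => (N <= size u)%N) C,
    \sum_(u <- C) ((k%:R `^ s) ^+ size u)^-1 <= eps & cylinder_cover (words k X) C].
Proof.
move=> s0 cX nullX eps0; set lam := k%:R `^ s.
have lam1 : 1 <= lam by exact: base_powR_ge1.
have lam0 : 0 < lam by exact: lt_le_trans lam1.
(* The final weight is at most [6 ^ d * (lam * e + e)]: one [e] for the cover, the other for the
   rounding slacks [e / 2 ^ (i + 1)]. *)
pose e := eps / ((6 ^ d)%:R * (lam + 1)).
have c0 : 0 < (6 ^ d)%:R * (lam + 1) :> R by rewrite mulr_gt0 ?addr_gt0 // ltr0n expn_gt0.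
have e0 : 0 < e by rewrite divr_gt0.
have dlt0 : 0 < (k ^ N)%:R^-1 :> R by rewrite invr_gt0 base_exp_gt0.
have [U [XU dU sU]] := hausdorff_null_cover dlt0 e0 nullX.
pose D i := fine (diameter (U i)).
have DE i : U i !=set0 -> diameter (U i) = (D i)%:E.
  move=> Ui; rewrite /D fineK // fin_numElt; apply/andP; split.
    exact: lt_le_trans (diameter_ge0 Ui).
  by apply: le_lt_trans (dU i) _; rewrite ltry.
(* The case split gives empty sets weight 0; the power of [D i = 0] would be 1 for [s = 0]. *)
pose a i : R := if pselect (U i !=set0) then D i `^ s else 0.
have aE i : diameter_pow s (U i) = (a i)%:E.
  rewrite /diameter_pow /a; case: pselect => U0; case: pselect => Ui //.
  - by have /set0P/eqP := Ui.
  - by rewrite (DE i Ui) poweR_EFin.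
  - by case: Ui; apply/set0P/eqP.
have a0 i : 0 <= a i by rewrite -lee_fin -aE diameter_pow_ge0.
have /choice[p Hp] i : exists p : nat * 'rV[R]_d, U i !=set0 ->
    [/\ (N <= p.1)%N, U i p.2, D i <= (k ^ p.1)%:R^-1 &
      (lam ^+ p.1)^-1 <= lam * a i + e * (2 ^+ i.+1)^-1].
  have [Ui|nU] := pselect (U i !=set0); last by exists (0%N, 0).
  have [x Ux] := Ui.
  have [|||n [n1 n2 n3]] := @scale_exists (D i) s (e * (2 ^+ i.+1)^-1) N s0.
  - by rewrite mulr_gt0 // invr_gt0 exprn_gt0.
  - by rewrite -lee_fin -DE // diameter_ge0.
  - by rewrite -lee_fin -DE.
  by exists (n, x) => _; split => //=; rewrite /a; case: pselect.
(* The sets [U i] need not be open. A sup-norm ball around a point of [U i], of radius twice the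
   bound on its diameter, is open and contains it. *)
pose V i := if pselect (U i !=set0) then ball (p i).2 (2 / (k ^ (p i).1)%:R) else set0.
have Vopen i : open (V i).
  by rewrite /V; case: pselect => ?; [exact: ball_open|exact: open0].
have XV : X `<=` cover setT V.
  move=> x /XU[i _ Ux]; exists i => //; rewrite /V.
  have Ui : U i !=set0 by exists x.
  case: pselect => // ?; have [_ Up Dp _] := Hp i Ui.
  have k0 := base_exp_gt0 hk (p i).1 (R := R).
  split; first by rewrite divr_gt0.
  move=> j1 j; rewrite (ord1 j1) /ball /=.
  apply: (@le_lt_trans _ _ (D i)).
    apply: le_trans (coord_dist_le _ _ j) _.
    by rewrite -lee_fin -DE // euclidean_dist_le_diameter.
  apply: le_lt_trans Dp _; rewrite ltr_pdivlMr // mulVf ?gt_eqF //; lra.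
have [D' _ XD'] : finite_subset_cover setT V X.
  by move: cX; rewrite compact_cover => /(_ _ setT V); apply.
pose M := (\max_(i <- finmap.enum_fset D') i).+1.
pose near n x := [seq tval t | t <- enum (words_near n x)].
pose C i := if pselect (U i !=set0) then near (p i).1 (p i).2 else [::].
have size_near n x u : u \in near n x -> size u = n.
  by move=> /mapP[t _ ->]; rewrite size_tuple.
exists (flatten [seq C i | i <- index_iota 0 M]); split.
- apply/allP => u /flatten_mapP[i _]; rewrite /C; case: pselect => // Ui.
  by move=> /size_near ->; have [] := Hp i Ui.
- rewrite big_flatten big_map /=.
  apply: (@le_trans _ _ (\sum_(0 <= i < M) (6 ^ d)%:R * (lam * a i + e * (2 ^+ i.+1)^-1))).
    apply: ler_sum => i _; rewrite /C; case: pselect => Ui; last first.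
      rewrite big_nil mulr_ge0 // addr_ge0 // mulr_ge0 // ?invr_ge0 ?exprn_ge0 // ltW //.
    rewrite big_seq (eq_bigr (fun=> (lam ^+ (p i).1)^-1)); last by move=> u /size_near ->.
    rewrite -big_seq big_const_seq count_predT iter_addr_0 -[leLHS]mulr_natl.
    have [_ _ _ h] := Hp i Ui.
    apply: ler_pM => //; first by rewrite invr_ge0 exprn_ge0 // ltW.
    by rewrite ler_nat size_map -cardE card_words_near.
  rewrite -mulr_sumr big_split /= -!mulr_sumr.
  have sa : \sum_(0 <= i < M) a i <= e.
    rewrite -lee_fin -sumEFin; apply: le_trans (ltW sU).
    rewrite (eq_bigr (fun i => diameter_pow s (U i))) => [|i _]; last by rewrite aE.
    by apply: nneseries_lim_ge => i _ _; apply: diameter_pow_ge0.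
  have sh := sum_half_pow M.
  rewrite (_ : eps = (6 ^ d)%:R * (lam * e + e * 1)); last first.
    rewrite -[LHS](@divfK _ ((6 ^ d)%:R * (lam + 1))) ?gt_eqF // -/e; ring.
  by rewrite ler_pM2l ?ltr0n ?expn_gt0 // lerD // ler_pM2l.
- move=> w [x Xx xw]; have [i iD' Vx] := XD' x Xx.
  move: Vx; rewrite /V; case: pselect => // Ui [_ Vx].
  exists (mkseq w (p i).1); last by rewrite size_mkseq.
  apply/flatten_mapP; exists i.
    by rewrite mem_index_iota /M ltnS; apply: (@leq_bigmax_seq _ _ xpredT id).
  rewrite /C; case: pselect => // ?; apply/mapP.
  exists [tuple of mkseq w (p i).1] => //; rewrite mem_enum inE; apply/asboolP => j.
  have k0 := base_exp_gt0 hk (p i).1 (R := R).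
  have := Vx ord0 j; rewrite /ball /= ltr_pdivlMr // => h.
  have /(word_of_pointP hk)/(_ (p i).1 j) := xw.
  move: h; rewrite -[X in _ * X](ger0_norm (ltW k0)) -normrM ltr_norml => /andP[h1 h2] /andP[h3 h4].
  rewrite ltr_norml; apply/andP; split; nra.
Qed.

End NullSets.

(** * Covers by k-adic cubes *)

Section UpperBound.
Context {R : realType} {d k : nat} (hk : (2 <= k)%N).
Implicit Types (X U : set 'rV[R]_d) (x : 'rV[R]_d).

(** The diagonal has length [sqrt d] times the side; the cruder factor [d] suffices and avoids the
    root. *)
Lemma diameter_cell n b U : U `<=` cell k n b ->
  (diameter U <= (d%:R * (k ^ n)%:R^-1)%:E)%E.
Proof.
move=> Ub; apply: ge_ereal_sup => _ [[x y] [/= Ux Uy] <-]; rewrite lee_fin.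
have k0 := base_exp_gt0 hk n (R := R).
have kV0 : 0 <= (k ^ n)%:R^-1 :> R by rewrite invr_ge0 ltW.
rewrite -[leRHS]ger0_norm ?mulr_ge0 // -sqrtr_sqr.
rewrite ler_sqrt ?sqr_ge0 //.
apply: (@le_trans _ _ (\sum_(i < d) (k ^ n)%:R^-1 ^+ 2)).
  apply: ler_sum => i _; rewrite -real_normK ?num_real // ler_sqr ?nnegrE //.
  have := Ub _ Ux i; have := Ub _ Uy i => /andP[y1 y2] /andP[x1 x2].
  rewrite -[leRHS]mul1r ler_pdivlMr // -[X in _ * X](ger0_norm (ltW k0)) -normrM.
  by rewrite ler_norml; apply/andP; split; lra.
rewrite sumr_const card_ord -[leLHS]mulr_natl exprMn ler_wpM2r ?sqr_ge0 //.
by rewrite -natrX ler_nat -[leqLHS]expn1; case: d => // d'; rewrite leq_pexp2l.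
Qed.

Lemma diameter_pow_le s U (D : R) : 0 <= s -> 0 <= D ->
  (diameter U <= D%:E)%E -> (diameter_pow s U <= (D `^ s)%:E)%E.
Proof.
move=> s0 D0 UD; rewrite /diameter_pow; case: pselect => /= [_|U0].
  by rewrite lee_fin powR_ge0.
have d0 : (0 <= diameter U)%E by apply: diameter_ge0; apply/set0P/eqP.
rewrite -poweR_EFin; apply: gt0_ler_poweR => //; rewrite in_itv /= leey andbT //.
Qed.

Lemma hausdorff_measure_eq0 s X :
  (forall delta eps : R, 0 < delta -> 0 < eps ->
    (hausdorff_premeasure s delta X <= eps%:E)%E) ->
  hausdorff_measure s X = 0%E.
Proof.
move=> H; apply/eqP; rewrite eq_le; apply/andP; split.
  apply: ge_ereal_sup => _ [delta delta0 <-]; apply/lee_addgt0Pr => eps eps0.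
  by rewrite add0e; apply: H.
apply: (@le_trans _ _ (hausdorff_premeasure s 1 X)); last first.
  by apply: ereal_sup_ubound; exists 1 => /=.
apply: le_ereal_inf_tmp => _ [U _ <-].
by apply: nneseries_ge0 => i _ _; apply: diameter_pow_ge0.
Qed.

(** The cubes of the words of length [n] have total [s']-weight at most a constant times
    [(lam / lam') ^ n]. One large [n] serves given [delta] and [eps], so infinitely many good [n]
    are enough. *)
Lemma null_of_complexity (s s' : R) X : X `<=` unit_cube -> 0 <= s < s' ->
  (forall N, exists2 n, (N <= n)%N &
     (complexity (@language R d k X) n)%:R <= (k%:R `^ s) ^+ n) ->
  hausdorff_measure s' X = 0%E.
Proof.
move=> X01 /andP[s0 ss'] H; apply: hausdorff_measure_eq0 => delta eps delta0 eps0.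
have s'0 : 0 <= s' by apply: le_trans (ltW ss').
set lam := k%:R `^ s in H; set lam' := k%:R `^ s'.
have k0 : 0 < k%:R :> R by rewrite ltr0n ltnW.
have lam0 : 0 < lam by rewrite powR_gt0.
have lam'0 : 0 < lam' by rewrite powR_gt0.
have lamlt : lam < lam'.
  have : 1 < k%:R `^ (s' - s) by apply: base_powR_gt1; rewrite // subr_gt0.
  rewrite powRB; last by rewrite gt_eqF ?implybT.
  by rewrite ltr_pdivlMr // mul1r.
pose dd : R := d%:R + 1.
have dd0 : 0 < dd by rewrite ltr_wpDl.
have [N1 HN1] := base_expV_lt_eventually hk (divr_gt0 delta0 dd0).
have [|N2 HN2] := @expr_lt_eventually _ (lam / lam') (eps / dd `^ s') _ (divr_gt0 eps0 (powR_gt0 s' dd0)).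
  by rewrite divr_ge0 ?ltW //= ltr_pdivrMr // mul1r.
have [n nN Pn] := H (maxn N1 N2).
have [n1 n2] : (N1 <= n /\ N2 <= n)%N by lia.
pose S : seq (seq (letter k)) :=
  [seq tval u | u <- enum [set u : n.-tuple (letter k) | `[< @language R d k X (tval u) >]]%SET].
have sizeS : size S = complexity (@language R d k X) n by rewrite size_map -cardE.
(* The finite family is padded with empty sets, which have weight 0. *)
pose U i : set 'rV[R]_d := if (i < size S)%N then
  X `&` cell k n (word_coord (nth [::] S i)) else set0.
pose r : R := d%:R * (k ^ n)%:R^-1.
have r0 : 0 <= r by rewrite mulr_ge0 // invr_ge0.
have rdd : r <= dd * (k ^ n)%:R^-1.
  by rewrite ler_wpM2r ?invr_ge0 // lerDl.
have diamU i : (diameter (U i) <= r%:E)%E.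
  rewrite /U; case: ifP => _; last first.
    by apply: ge_ereal_sup => _ [[x y] [[]]].
  exact: (@diameter_cell n (word_coord (nth [::] S i))).
apply: (@le_trans _ _ (\sum_(0 <= i <oo) diameter_pow s' (U i))%E).
  apply: ereal_inf_lbound; exists U => //; split=> [x Xx|i].
    have [w xw] := word_of_point_exists hk (X01 _ Xx).
    have uS : mkseq w n \in S.
      apply/mapP; exists [tuple of mkseq w n] => //; rewrite mem_enum inE.
      by apply/asboolP; exists x, w, 0%N, n.
    exists (index (mkseq w n) S) => //.
    rewrite /U index_mem uS nth_index //; split => //.
    by move/(word_of_pointP hk): xw; apply.
  apply: le_trans (diamU i) _; rewrite lee_fin; apply: le_trans rdd _.
  by rewrite -ler_pdivlMl // mulrC ltW // HN1.
rewrite (nneseries_split 0 (size S)); last by move=> *; apply: diameter_pow_ge0.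
rewrite add0n [X in (_ + X)%E]eseries0 ?adde0; last first.
  move=> i Si _; rewrite /U ltnNge Si /= /diameter_pow.
  by case: pselect.
apply: (@le_trans _ _ (\sum_(0 <= i < size S) ((dd `^ s') * (lam' ^+ n)^-1)%:E)%E).
  apply: lee_sum => i _; apply: le_trans (diameter_pow_le s'0 r0 (diamU i)) _.
  rewrite lee_fin -powR_base_expV -powRM ?invr_ge0 //; last exact: ltW.
  by apply: ge0_ler_powR; rewrite // ?nnegrE // mulr_ge0 ?invr_ge0 // ltW.
rewrite sumEFin lee_fin sumr_const_nat subn0 sizeS -mulr_natl.
apply: (@le_trans _ _ (lam ^+ n * (dd `^ s' * (lam' ^+ n)^-1))).
  by rewrite ler_wpM2r // mulr_ge0 ?powR_ge0 // invr_ge0 exprn_ge0 // ltW.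
have := HN2 n n2; rewrite expr_div_n ltr_pdivlMr ?powR_gt0 // => h.
by apply: ltW; rewrite mulrCA mulrC.
Qed.

End UpperBound.

(** * Comparison with the entropy *)

Section Entropy.
Context {R : realType} {d k : nat} (hk : (2 <= k)%N) (X : set 'rV[R]_d).
Hypothesis hX : self_similar k X.

Let P n : nat := complexity (@language R d k X) n.
Let e n : R := ln (P n)%:R / ln k%:R / n%:R.

Lemma ln_base_gt0 : 0 < ln k%:R :> R.
Proof. by rewrite ln_gt0 // ltr1n. Qed.

Lemma entropy_seq_ge0 n : 0 <= e n.
Proof.
rewrite /e !mulr_ge0 ?invr_ge0 ?(ltW ln_base_gt0) //.
by case: (P n) => [|p]; [rewrite ln0|rewrite ln_ge0 // ler1n].
Qed.

(** The constant [K] of the bound [K * k ^ (s n)] adds only [ln K / (n ln k)], eventually at most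
    [eps]. *)
Lemma null_entropy_le (s eps : R) : 0 <= s -> hausdorff_measure s X = 0%E ->
  0 < eps -> \forall n \near \oo, e n <= s + eps.
Proof.
move=> s0 nullX eps0; have [_ cX finX] := hX.
have [K K0 HK] := complexity_le (base_powR_ge1 hk s0) (residual_words_finite hk finX)
  (fun eps N => null_small_cylinder_cover hk N s0 cX nullX).
have l0 := ln_base_gt0.
near=> n.
have n0 : 0 < n%:R :> R by rewrite ltr0n; near: n; exists 1%N.
have nK : ln K / ln k%:R / eps <= n%:R by near: n; exact: nbhs_infty_ger.
have [Pn0|Pn0] := posnP (P n).
  by rewrite /e Pn0 ln0 // !mul0r addr_ge0 // ltW.
have lam0 : 0 < k%:R `^ s :> R by rewrite powR_gt0 // ltr0n ltnW.
have : ln (P n)%:R <= ln (K * (k%:R `^ s) ^+ n).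
  rewrite ler_ln ?posrE ?ltr0n ?mulr_gt0 ?exprn_gt0 //.
  by rewrite /P language_factor; apply: HK.
rewrite lnM ?posrE ?exprn_gt0 // lnXn // ln_powR => h.
rewrite /e !ler_pdivrMr //; apply: le_trans h _.
move: nK; rewrite !ler_pdivrMr // -mulr_natr; lra.
Unshelve. all: by end_near.
Qed.

Lemma entropy_lt_null (s s' : R) : 0 <= s < s' ->
  (forall N, exists2 n, (N <= n)%N & e n <= s) -> hausdorff_measure s' X = 0%E.
Proof.
move=> ss' H; have [X01 _ _] := hX; apply: (null_of_complexity hk X01 ss') => N.
(* Asking for [N.+1] makes [n] positive, so that the division by [n] can be undone. *)
have [n Nn en] := H N.+1; exists n; first exact: ltnW.
have k0 : 0 < k%:R :> R by rewrite ltr0n ltnW.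
have lam0 : 0 < k%:R `^ s :> R by rewrite powR_gt0.
rewrite -/(P n); have [->|Pn0] := posnP (P n); first by rewrite exprn_ge0 // ltW.
rewrite -ler_ln ?posrE ?ltr0n ?exprn_gt0 // lnXn // ln_powR.
move: en; rewrite /e !ler_pdivrMr ?ln_base_gt0 ?ltr0n //; last by apply: leq_trans Nn.
by rewrite -[_ * _ *+ n]mulr_natr [_ * ln _ * _]mulrAC.
Qed.

Lemma entropy_seq_le n : e n <= d%:R.
Proof.
have [->|n0] := posnP n; first by rewrite /e invr0 mulr0.
have [Pn0|Pn0] := posnP (P n); first by rewrite /e Pn0 ln0 // !mul0r.
have k0 : (0 < k)%N by exact: ltnW.
rewrite /e !ler_pdivrMr ?ln_base_gt0 ?ltr0n //.
have PdN : (P n <= k ^ (d * n))%N.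
  apply: leq_trans (max_card _) _.
  by rewrite card_tuple card_ffun !card_ord -expnM.
apply: (@le_trans _ _ (ln (k ^ (d * n))%:R)).
  by rewrite ler_ln ?posrE ?ltr0n ?expn_gt0 ?k0 // ler_nat.
by rewrite natrX lnXn ?ltr0n // -[_ *+ (d * n)]mulr_natl natrM.
Qed.

(* The existence of the limit needs no appeal to subadditivity. *)
Lemma entropy_seq_cvg : exists2 D : R, hausdorff_dim X = D%:E & e @ \oo --> D.
Proof.
(* Some exponent is null, so the dimension is finite; [d + 1] exceeds the trivial bound [d] on the
   entropy sequence. *)
have null_d : hausdorff_measure (d%:R + 1 : R) X = 0%E.
  apply: (@entropy_lt_null d%:R); first by rewrite ler0n ltrDl ltr01.
  by move=> N; exists N => //; apply: entropy_seq_le.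
have dim_ge0 : (0 <= hausdorff_dim X)%E.
  by apply: le_ereal_inf_tmp => _ [s [s0 _] <-]; rewrite lee_fin.
have dim_le s : 0 <= s -> hausdorff_measure s X = 0%E -> (hausdorff_dim X <= s%:E)%E.
  by move=> s0 Hs; apply: ereal_inf_lbound; exists s.
have dim_fin : hausdorff_dim X \is a fin_num.
  rewrite fin_numElt (lt_le_trans _ dim_ge0) //=.
  by apply: le_lt_trans (dim_le _ _ null_d) (ltry _); rewrite addr_ge0.
pose D := fine (hausdorff_dim X).
have DE : hausdorff_dim X = D%:E by rewrite /D fineK.
exists D => //; apply/cvgrPdist_le => eps eps0.
(* Otherwise values below [D - eps] recur, and [D - eps / 2] is a null exponent below the infimum
   [D]. *)
have lower : \forall n \near \oo, D - eps <= e n.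
  apply: contrapT => nlow.
  have freq N : exists2 n, (N <= n)%N & e n < D - eps.
    apply: contrapT => h; apply: nlow; exists N => // n Nn /=.
    by rewrite leNgt; apply/negP => en; apply: h; exists n.
  have s0 : 0 <= D - eps.
    by have [n _ en] := freq 0%N; apply: le_trans (entropy_seq_ge0 n) (ltW en).
  have null : hausdorff_measure (D - eps / 2) X = 0%E.
    apply: (@entropy_lt_null (D - eps)); first by rewrite s0 /=; lra.
    by move=> N; have [n Nn en] := freq N; exists n => //; apply: ltW.
  have : (hausdorff_dim X <= (D - eps / 2)%:E)%E by apply: dim_le => //; lra.
  by rewrite DE lee_fin; lra.
(* The infimum yields a null exponent [s < D + eps / 2], and the counting bound costs another
   [eps / 2]. *)
have upper : \forall n \near \oo, e n <= D + eps.
  have : (hausdorff_dim X < (D + eps / 2)%:E)%E by rewrite DE lte_fin; lra.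
  move=> /ereal_inf_lt[_ [s [s0 Hs] <-]]; rewrite lte_fin => sD.
  have e2 : 0 < eps / 2 by lra.
  apply: filterS (null_entropy_le s0 Hs e2) => n; lra.
near=> n; rewrite ler_norml; apply/andP; split.
  have : e n <= D + eps by near: n.
  lra.
have : D - eps <= e n by near: n.
lra.
Unshelve. all: by end_near.
Qed.

End Entropy.

Theorem theorem1p1 (R : realType) (d k : nat) (hd : (1 <= d)%N)
    (hk : (2 <= k)%N) (X : set 'rV[R]_d) (hX : self_similar k X) :
  hausdorff_dim X = (entropy k X)%:E.
Proof.
have [D -> eD] := entropy_seq_cvg hk hX.
by congr EFin; rewrite /entropy; apply/esym/cvg_lim.
Qed.
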